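(* Let $q$ be a prime power, let $\mathscr{S}_T$ be a tangent splash of $\ell_\infty$ in $\mathrm{PG}(2,q^3)$ with centre $T$, and let $m$ be an order-$q$-subline containing $T$ and contained in a line other than $\ell_\infty$. Then there are exactly $q(q^2-1)$ order-$q$-subplanes meeting $\ell_\infty$ in exactly one point that contain $m$ and have tangent splash $\mathscr{S}_T$.
   Context: An order-$q$-subplane of $\mathrm{PG}(2,q^3)$ is a subplane of order $q$ (an image of $\mathrm{PG}(2,q)$ under $\mathrm{PGL}(3,q^3)$). An order-$q$-subline of a line is an image of $\mathrm{PG}(1,q)$ under $\mathrm{PGL}(2,q^3)$. If $\pi$ is an order-$q$-subplane meeting $\ell_\infty$ in exactly one point $T$, its tangent splash is the set of $q^2+1$ points of $\ell_\infty$ lying on the extension of some line of $\pi$; $T$ is its centre. A tangent splash with centre $T$ is any set arising this way. *)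

(* Defs.v *)
From HB Require Import structures.
From mathcomp Require Import all_boot all_algebra.

Set Implicit Arguments.
Unset Strict Implicit.
Unset Printing Implicit Defensive.

Import GRing.Theory.
Local Open Scope ring_scope.

(* The subspaces of K^n of vector dimension k, i.e. the flats of projective
   dimension k - 1 of PG(n - 1, K).  A subspace is stored as the canonical
   square matrix <<U>>%MS of its row space, so that Leibniz equality is
   equality of subspaces. *)
Record flat (K : finFieldType) (n k : nat) := Flat {
  flat_mx :> 'M[K]_n;
  _ : (<<flat_mx>>%MS == flat_mx) && (\rank flat_mx == k)
}.
HB.instance Definition _ (K : finFieldType) (n k : nat) :=
  [isSub for @flat_mx K n k].
HB.instance Definition _ (K : finFieldType) (n k : nat) :=
  [Countable of flat K n k by <:].
HB.instance Definition _ (K : finFieldType) (n k : nat) :=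
  [Finite of flat K n k by <:].

Notation point K n := (flat K n 1).
Notation line K n := (flat K n 2).

Section Subgeometries.

Variables (F L : finFieldType) (iota : {rmorphism F -> L}).

(* The image in PG(n - 1, L) of the k-dimensional flats of PG(m - 1, F) under
   the map with matrix B.  Matrices act on row vectors from the right. *)
Definition image_flats (m n k : nat) (B : 'M[L]_(m, n)) : {set flat L n k} :=
  [set U : flat L n k |
    [exists V : flat F m k, (U == map_mx iota V *m B)%MS]].

(* A configuration of points and lines of PG(2, L).  The lines of a subplane
   are recorded as their extensions, i.e. as lines of PG(2, L). *)
Definition plane_config : Type := ({set point L 3} * {set line L 3})%type.

Definition subplane (pi : plane_config) : bool :=
  [exists g : 'M[L]_3,
    (g \in unitmx) && (pi == (image_flats 1 g, image_flats 2 g))].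

(* Identifying the line l with PG(1, L) and then applying an element of
   PGL(2, L) amounts to choosing a basis of l; the rows of B are that basis. *)
Definition subline (l : line L 3) (m : {set point L 3}) : bool :=
  [exists B : 'M[L]_(2, 3), (B == l)%MS && (m == image_flats 1 B)].

Definition points_on (pi : plane_config) (l : line L 3) : {set point L 3} :=
  [set P in pi.1 | (P <= l)%MS].

Definition splash (pi : plane_config) (l : line L 3) : {set point L 3} :=
  [set P : point L 3 | (P <= l)%MS && [exists b in pi.2, (P <= b)%MS]].

Definition tangent_splash (l : line L 3) (T : point L 3)
    (S : {set point L 3}) : bool :=
  [exists pi : plane_config,
    [&& subplane pi, points_on pi l == [set T] & splash pi l == S]].

End Subgeometries.

(* Main.v *)
(* Write a subplane as an F-space V of rank 3 spanning L^3, up to scalars, and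
   let phi be a linear form with kernel linf.  If the subplane meets linf only
   in T = <t>, then phi has kernel F t on V, and for a basis t, a, b of V with
   alpha = phi a and beta = phi b the lines of the subplane meet linf in T and
   in the points <s t + e>, where e = alpha b - beta a and s runs over the
   F-plane A spanned by alpha and beta.  Fix such t and e for the given splash,
   and p with phi p = 1 and m = PG(<t, p>_F).  After scaling, a tangent subplane
   containing m is V = <v t, v p, s t + u p + e>, with v, u independent over F,
   and its splash is T together with the points over the affine F-plane
   s + <v, u>; so its splash is the given one iff v, u, s lie in A.  Two triples
   give the same subplane iff they are related by v -> k v, u -> u + x v,
   s -> s + y v with k, x, y in F and k nonzero.  Hence the subplanes correspond
   to a direction F v of A (q + 1 choices), a nonzero class u in A / F v (q - 1
   choices) and a class s in A / F v (q choices). *)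

Require Import Defs.
From HB Require Import structures.
From mathcomp Require Import all_boot all_algebra.
From mathcomp Require Import ring.

Set Implicit Arguments.
Unset Strict Implicit.
Unset Printing Implicit Defensive.

Import GRing.Theory.
Local Open Scope ring_scope.

(** * Points and images of flats *)

Section Flats.

Variables (K : finFieldType) (n k : nat).

Lemma flat_inj (U V : flat K n k) : (U == V)%MS -> U = V.
Proof.
have genE (W : flat K n k) : <<W>>%MS = W by have /andP[/eqP] := valP W.
move=> /eqmxP UV; apply: val_inj; rewrite /= -[LHS]genE -[RHS]genE.
exact: eq_genmx.
Qed.

Lemma mxrank_flat (U : flat K n k) : \rank U = k.
Proof. by have /andP[_ /eqP] := valP U. Qed.

Lemma flat_of_rank m (A : 'M[K]_(m, n)) :
  \rank A = k -> exists U : flat K n k, (U :=: A)%MS.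
Proof.
move=> rA; have UP : (<<(<<A>>)>>%MS == <<A>>%MS) && (\rank <<A>>%MS == k).
  by rewrite genmx_id eqxx mxrank_gen rA eqxx.
by exists (Flat UP); apply: genmxE.
Qed.

End Flats.

Section Points.

Variables (K : finFieldType) (n : nat).

Lemma point_of (x : 'rV[K]_n) : x != 0 -> exists P : point K n, (P :=: x)%MS.
Proof. by move=> x0; apply: flat_of_rank; rewrite rank_rV x0. Qed.

Lemma point_rep (P : point K n) : exists2 x : 'rV[K]_n, x != 0 & (P :=: x)%MS.
Proof.
have P0 : nz_row P != 0 by rewrite nz_row_eq0 -mxrank_eq0 mxrank_flat.
exists (nz_row P) => //; apply/eqmxP; rewrite andbC.
by rewrite -(geq_leqif (mxrank_leqif_eq (nz_row_sub P))) mxrank_flat rank_rV P0.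
Qed.

Lemma eq_rowP (x y : 'rV[K]_n) :
  reflect (exists2 c, c != 0 & x = c *: y) (x == y)%MS.
Proof.
apply: (iffP idP) => [/andP[/sub_rVP[c xE] yx]|[c c0 ->]]; last first.
  by apply/eqmxP/eqmx_scale.
(* A zero scalar makes both rows vanish, and then the scalar 1 serves. *)
have [c0|c0] := eqVneq c 0; last by exists c.
have x0 : x = 0 by rewrite xE c0 scale0r.
move: yx; rewrite x0 => /sub_rVP[a ->].
by exists 1; rewrite ?oner_eq0 // !scaler0.
Qed.

End Points.

Lemma row_free_extend (K : fieldType) m k (X : 'M[K]_(m, m + k)) :
  row_free X -> exists2 Y : 'M[K]_(m + k), Y \in unitmx & usubmx Y = X.
Proof.
(* [X] is the standard m-space times a square matrix that is injective on it; such a matrix can be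
   made invertible without changing it there. *)
move=> rX; have XE : X = row_mx 1%:M 0 *m col_mx X (0 : 'M_(k, m + k)).
  by rewrite mul_row_col mul1mx mul0mx addr0.
have rU : \rank (row_mx (1%:M : 'M[K]_m) (0 : 'M_(m, k))) = m.
  apply/eqP/row_freeP; exists (col_mx 1%:M 0).
  by rewrite mul_row_col mul1mx mul0mx addr0.
have [|Y Yu] := @complete_unitmx _ _ _ (row_mx 1%:M 0)
                   (col_mx X (0 : 'M_(k, m + k))).
  by rewrite -XE rU; apply/eqP.
rewrite -XE => XY; exists Y => //.
by rewrite XY -{2}[Y]vsubmxK mul_row_col mul1mx mul0mx addr0.
Qed.

Section ImageFlats.

Variables (F L : finFieldType) (iota : {rmorphism F -> L}).
Local Notation "A ^f" := (map_mx iota A) : ring_scope.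

Lemma image_pointsP m n (B : 'M[L]_(m, n)) (P : point L n) :
  reflect (exists2 u : 'rV[F]_m, u != 0 & (P :=: u^f *m B)%MS)
          (P \in image_flats iota 1 B).
Proof.
rewrite inE; apply: (iffP existsP) => [[V /eqmxP PV]|[u u0 Pu]].
  have [u u0 Vu] := point_rep V; exists u => //.
  apply: (eqmx_trans PV); apply: eqmxMr; apply/eqmxP.
  by rewrite !map_submx; apply/eqmxP.
have [V Vu] := point_of u0; exists V; apply/eqmxP.
apply: (eqmx_trans Pu); apply: eqmxMr; apply/eqmxP.
by rewrite !map_submx andbC; apply/eqmxP.
Qed.

Lemma image_flatsZ m n k (B : 'M[L]_(m, n)) c :
  c != 0 -> image_flats iota k (c *: B) = image_flats iota k B.
Proof.
move=> c0; apply/setP=> U; rewrite !inE; apply: eq_existsb => V.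
by rewrite -scalemxAr !(eqmx_scale _ c0).
Qed.

(** A change of basis over [F] permutes the flats over [F]; the two inclusions come from [X] and
    [invmx X]. *)
Lemma image_flatsM m n k (X : 'M[F]_m) (B : 'M[L]_(m, n)) :
  X \in unitmx -> image_flats iota k (X^f *m B) = image_flats iota k B.
Proof.
have sub (Y : 'M[F]_m) (C : 'M[L]_(m, n)) : Y \in unitmx ->
    image_flats iota k (Y^f *m C) \subset image_flats iota k C.
  move=> Yu; apply/subsetP=> U; rewrite !inE => /existsP[V /eqmxP UV].
  have [|W WV] := @flat_of_rank _ _ k _ (V *m Y).
    by rewrite mxrankMfree ?row_free_unit ?mxrank_flat.
  apply/existsP; exists W; apply/eqmxP; apply: (eqmx_trans UV).
  rewrite mulmxA -map_mxM; apply: eqmxMr; apply/eqmxP.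
  by rewrite !map_submx andbC; apply/eqmxP.
move=> Xu; apply/eqP; rewrite eqEsubset sub //=.
have {1}-> : B = (invmx X)^f *m (X^f *m B).
  by rewrite mulmxA -map_mxM mulVmx // map_mx1 mul1mx.
by rewrite sub // unitmx_inv.
Qed.

(* The images of the m unit vectors and of their sum already determine B up to
   a scalar: this is the uniqueness of the projective map taking one frame to
   another. *)
Lemma sub_image_points m n (B : 'M[L]_(m, n)) (g : 'M[L]_n) :
  row_free B -> g \in unitmx ->
  image_flats iota 1 B \subset image_flats iota 1 g ->
  exists c, exists X : 'M[F]_(m, n), B = c *: (X^f *m g).
Proof.
move=> rB gu sBg.
have pt (u : 'rV[F]_m) : u != 0 ->
    exists c, exists x : 'rV[F]_n, u^f *m B = c *: (x^f *m g).
  move=> u0; have uB0 : u^f *m B != 0.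
    have := mxrankMfree (u^f) rB; rewrite !rank_rV map_mx_eq0 u0.
    by case: (_ *m _ != 0).
  have [P Pu] := point_of uB0.
  have /(subsetP sBg)/image_pointsP[x x0 Px] : P \in image_flats iota 1 B.
    by apply/image_pointsP; exists u.
  have : (u^f *m B <= x^f *m g)%MS by rewrite -Pu Px.
  by case/sub_rVP=> c ->; exists c, x.
have e_neq0 i : (delta_mx 0 i : 'rV[F]_m) != 0.
  apply/eqP=> /matrixP/(_ 0 i); rewrite !mxE !eqxx => /eqP.
  by rewrite oner_eq0.
have {e_neq0} BrowE i :
    exists cx : L * 'rV[F]_n, row i B == cx.1 *: (cx.2^f *m g).
  have [c [x]] := pt _ (e_neq0 i); rewrite map_delta_mx -rowE => ->.
  by exists (c, x).
pose d : 'rV[L]_m := \row_i (xchoose (BrowE i)).1.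
pose Y : 'M[F]_(m, n) := \matrix_i (xchoose (BrowE i)).2.
have BE : B = diag_mx d *m (Y^f *m g).
  apply/row_matrixP=> i; rewrite (eqP (xchooseP (BrowE i))).
  by rewrite row_mul row_diag_mx -scalemxAl -rowE row_mul -map_row rowK mxE.
(* For [m = 0] the all-one vector used below would be zero. *)
have [m0|m0] := posnP m.
  exists 0, 0; move: B {sBg pt BrowE d Y BE} rB; rewrite m0 => B _.
  by rewrite flatmx0 [RHS]flatmx0.
(* [Y] inherits full row rank from [B], hence has a right inverse. *)
have [Z YZ] : exists Z : 'M[F]_(n, m), Y *m Z = 1%:M.
  apply/row_freeP; rewrite /row_free eqn_leq rank_leq_row.
  rewrite -(mxrank_map iota Y).
  rewrite -(@mxrankMfree _ _ _ _ (Y^f) g) ?row_free_unit //.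
  by apply: leq_trans (mxrankM_maxr (diag_mx d) _); rewrite -BE (eqP rB).
have one0 : const_mx 1 != 0 :> 'rV[F]_m.
  by apply/eqP=> /matrixP/(_ 0 (Ordinal m0))/eqP; rewrite !mxE oner_eq0.
(* The image of the all-one vector compares the scalars of all rows: cancelling [g] and then [Y]
   shows that [d] is [c] times a vector over [F]. *)
have [c [x]] := pt _ one0; rewrite {1}BE !mulmxA scalemxAl.
move=> /(can_inj (mulmxK gu))/(congr1 (mulmx^~ (Z^f))).
rewrite -mulmxA -map_mxM YZ map_mx1 mulmx1 -scalemxAl -map_mxM => dE.
exists c, (diag_mx (x *m Z) *m Y); rewrite {1}BE map_mxM -mulmxA scalemxAl.
congr (_ *m _); have -> : d = c *: (x *m Z)^f.
  by rewrite -dE; apply/rowP=> i; rewrite mul_mx_diag !mxE rmorph1 mul1r.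
by apply/matrixP=> i j; rewrite !mxE rmorphMn /= mulrnAr.
Qed.

End ImageFlats.

(** * Linear forms and frames of PG(2, K) *)

Section Forms.

Variable K : fieldType.
Variable n : nat.

Definition form (phi : 'cV[K]_n) (x : 'rV[K]_n) : K := (x *m phi) 0 0.

Lemma formD phi x y : form phi (x + y) = form phi x + form phi y.
Proof. by rewrite /form mulmxDl mxE. Qed.

Lemma formZ phi c x : form phi (c *: x) = c * form phi x.
Proof. by rewrite /form -scalemxAl mxE. Qed.

Lemma form_eq0 phi x : (x *m phi == 0) = (form phi x == 0).
Proof.
apply/eqP/eqP=> [xphi|e]; first by rewrite /form xphi mxE.
by apply/matrixP=> i j; rewrite !ord1 [LHS]e mxE.
Qed.

Lemma sub_ker_form phi x : (x <= kermx phi)%MS = (form phi x == 0).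
Proof. by rewrite sub_kermx form_eq0. Qed.

End Forms.

(** A nonzero row killed by [W^T] gives the form; [W] lies in its kernel, and both have rank [n]. *)
Lemma form_of_corank1 (K : fieldType) m n (W : 'M[K]_(m, n.+1)) : \rank W = n ->
  exists2 phi : 'cV[K]_n.+1, phi != 0 & (W :=: kermx phi)%MS.
Proof.
move=> rW; pose psi := nz_row (kermx W^T).
have psi0 : psi != 0.
  by rewrite nz_row_eq0 -mxrank_eq0 mxrank_ker mxrank_tr rW subSnn.
have Wpsi : W *m psi^T = 0.
  apply: trmx_inj; rewrite trmx_mul trmxK trmx0; apply/eqP.
  by rewrite -sub_kermx nz_row_sub.
exists psi^T; first by rewrite trmx_eq0.
have WK : (W <= kermx psi^T)%MS by rewrite sub_kermx Wpsi.
apply/eqmxP; rewrite -(geq_leqif (mxrank_leqif_eq WK)) mxrank_ker mxrank_tr.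
by rewrite rank_rV psi0 rW subn1.
Qed.

Section Frames.

Variable K : fieldType.

Definition rv3 (R : nmodType) (x y z : R) : 'rV[R]_3 := \row_i [:: x; y; z]`_i.

Definition frame (t a b : 'rV[K]_3) : 'M[K]_3 := \matrix_i [:: t; a; b]`_i.

Lemma mul_frame x y z t a b :
  rv3 x y z *m frame t a b = x *: t + y *: a + z *: b.
Proof.
by rewrite mulmx_sum_row !big_ord_recl big_ord0 addr0 !rowK !mxE /= addrA.
Qed.

Lemma rv3E (x : 'rV[K]_3) : exists a b c, x = rv3 a b c.
Proof.
exists (x 0 0), (x 0 1), (x 0 (lift 0 1)); apply/rowP=> i; rewrite mxE.
by case: i => [[|[|[|]]]] //= ?; congr (x 0 _); apply: val_inj.
Qed.

Lemma rv3_eq0 (x y z : K) : (rv3 x y z == 0) = [&& x == 0, y == 0 & z == 0].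
Proof.
apply/eqP/and3P=> [/rowP e|[/eqP-> /eqP-> /eqP->]].
  by have := (e 0, e 1, e (lift 0 1)); rewrite !mxE /= => -[[-> ->] ->].
by apply/rowP=> i; rewrite !mxE; case: i => [[|[|[|]]]].
Qed.

Lemma form_rv3 (a b c x y z : K) :
  form (rv3 a b c)^T (rv3 x y z) = x * a + y * b + z * c.
Proof. by rewrite /form mxE !big_ord_recl big_ord0 addr0 !mxE addrA. Qed.

Lemma frameE (g : 'M[K]_3) :
  g = frame (row 0 g) (row 1 g) (row (lift 0 1) g).
Proof.
apply/row_matrixP=> i; rewrite rowK.
by case: i => [[|[|[|]]]] //= ?; congr (row _ g); apply: val_inj.
Qed.

Lemma frame_unitP t a b :
  reflect (forall x y z, x *: t + y *: a + z *: b = 0 ->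
             [/\ x = 0, y = 0 & z = 0])
          (frame t a b \in unitmx).
Proof.
rewrite -row_free_unit -kermx_eq0; apply: (iffP eqP) => [K0 x y z|ind].
  rewrite -mul_frame => /eqP; rewrite -sub_kermx K0 submx0 rv3_eq0.
  by case/and3P=> /eqP-> /eqP-> /eqP->.
apply/row_matrixP=> i.
have [x [y [z xyz]]] := rv3E (row i (kermx (frame t a b))).
have : row i (kermx (frame t a b)) *m frame t a b = 0.
  by apply/eqP; rewrite -sub_kermx row_sub.
rewrite xyz mul_frame row0 => /ind[-> -> ->].
by apply/eqP; rewrite rv3_eq0 !eqxx.
Qed.

Lemma frame_inj t a b x y z x' y' z' : frame t a b \in unitmx ->
  x *: t + y *: a + z *: b = x' *: t + y' *: a + z' *: b ->
  [/\ x = x', y = y' & z = z'].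
Proof.
move=> gu e; have : (x - x') *: t + (y - y') *: a + (z - z') *: b = 0.
  by rewrite !scalerBl (addrACA (x *: t)) -opprD addrACA -opprD e subrr.
by case/(frame_unitP _ _ _ gu)=> /subr0_eq-> /subr0_eq-> /subr0_eq->.
Qed.

Lemma frame_span t a b v : frame t a b \in unitmx ->
  exists x y z, v = x *: t + y *: a + z *: b.
Proof.
move=> gu; have [x [y [z e]]] := rv3E (v *m invmx (frame t a b)).
by exists x, y, z; rewrite -mul_frame -e mulmxKV.
Qed.

End Frames.

(** * Splashes of tangent subplanes *)

Section Tangency.

Variables (F L : finFieldType) (iota : {rmorphism F -> L}).
Local Notation "A ^f" := (map_mx iota A) : ring_scope.

Definition conf (g : 'M[L]_3) : plane_config L :=
  (image_flats iota 1 g, image_flats iota 2 g).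

Lemma subplaneP pi :
  reflect (exists2 g, g \in unitmx & pi = conf g) (subplane iota pi).
Proof.
apply: (iffP existsP) => [[g /andP[gu /eqP->]]|[g gu ->]]; exists g => //.
by rewrite gu eqxx.
Qed.

Lemma confM (X : 'M[F]_3) g : X \in unitmx -> conf (X^f *m g) = conf g.
Proof. by move=> Xu; rewrite /conf !image_flatsM. Qed.

Lemma confZ c g : c != 0 -> conf (c *: g) = conf g.
Proof. by move=> c0; rewrite /conf !image_flatsZ. Qed.

Lemma map_rv3 (x y z : F) : (rv3 x y z)^f = rv3 (iota x) (iota y) (iota z).
Proof.
by apply/rowP=> i; rewrite !mxE; case: i => [[|[|[|]]]] //= _; rewrite ?rmorph0.
Qed.

(* Inside %MS the symbol + is the sum of subspaces, hence the %R below. *)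
Lemma conf_pointP (t a b : 'rV[L]_3) (P : point L 3) :
  reflect (exists x y z, rv3 x y z != 0 /\
             (P :=: (iota x *: t + iota y *: a + iota z *: b)%R)%MS)
          (P \in (conf (frame t a b)).1).
Proof.
apply: (iffP (image_pointsP _ _ _)) => [[u]|[x [y [z [xyz0 PE]]]]].
  have [x [y [z ->]]] := rv3E u; rewrite map_rv3 mul_frame => u0 PE.
  by exists x, y, z.
by exists (rv3 x y z); rewrite // map_rv3 mul_frame.
Qed.

(** A rank 2 flat over [F] is the kernel of a form over [F], and extension of scalars preserves
    kernels. So in the coordinates given by the rows of [g] a line of the subplane has an equation
    over [F]. *)
Lemma conf_line_normal g (b : line L 3) : g \in unitmx -> b \in (conf g).2 ->
  exists n0 n1 n2, rv3 n0 n1 n2 != 0 /\ forall x y z,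
    (rv3 x y z *m g <= b)%MS = (x * iota n0 + y * iota n1 + z * iota n2 == 0).
Proof.
move=> gu; rewrite inE => /existsP[V /eqmxP bE].
have [n n_neq0 VE] := form_of_corank1 (mxrank_flat V).
have [n0 [n1 [n2 nE]]] := rv3E n^T.
exists n0, n1, n2; split=> [|x y z]; first by rewrite -nE trmx_eq0.
rewrite -form_rv3 -map_rv3 -nE map_trmx trmxK -sub_ker_form bE.
rewrite submxMfree ?row_free_unit // -map_kermx.
suff /eqmxP-> : (V^f == (kermx n)^f)%MS by [].
by rewrite !map_submx; apply/eqmxP.
Qed.

(** The passage back from an equation over [F] to a line of the subplane, used to exhibit points of
    the splash. *)
Lemma conf_line_of g n0 n1 n2 : g \in unitmx -> rv3 n0 n1 n2 != 0 ->
  exists2 b : line L 3, b \in (conf g).2 & forall x y z,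
    x * iota n0 + y * iota n1 + z * iota n2 = 0 -> (rv3 x y z *m g <= b)%MS.
Proof.
move=> gu n_neq0; pose n := (rv3 n0 n1 n2)^T.
have rn : \rank (kermx n) = 2 by rewrite mxrank_ker mxrank_tr rank_rV n_neq0.
have [V VE] := flat_of_rank rn.
have [|b bE] := @flat_of_rank L 3 2 _ (V^f *m g).
  by rewrite mxrankMfree ?row_free_unit // mxrank_map mxrank_flat.
exists b => [|x y z xn].
  by rewrite inE; apply/existsP; exists V; apply/eqmxP.
rewrite bE submxMr //.
suff /eqmxP-> : (V^f == (kermx n)^f)%MS.
  by rewrite map_kermx sub_ker_form /n -map_trmx map_rv3 form_rv3 xn.
by rewrite !map_submx; apply/eqmxP.
Qed.

(** Applied to the values of [phi] at the last two vectors of a frame whose first vector lies on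
    [l], this expresses tangency of the subplane to [l]. *)
Definition free2 (alpha beta : L) :=
  forall x y : F, iota x * alpha + iota y * beta = 0 -> x = 0 /\ y = 0.

Lemma free2_neq0 alpha beta : free2 alpha beta -> alpha != 0.
Proof.
move=> fr; apply/eqP=> a0.
have [|/eqP] := fr 1 0; first by rewrite a0 rmorph0 mulr0 mul0r addr0.
by rewrite oner_eq0.
Qed.

Variables (l : line L 3) (phi : 'cV[L]_3).
Hypothesis phiP : forall x : 'rV_3, (x <= l)%MS = (form phi x == 0).

Section WithFrame.

Variables (t a b : 'rV[L]_3).
Hypothesis gu : frame t a b \in unitmx.
Hypothesis phit : form phi t = 0.

Let formE x y z : form phi (x *: t + y *: a + z *: b)
  = y * form phi a + z * form phi b.
Proof. by rewrite !formD !formZ phit mulr0 add0r. Qed.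

Let t_neq0 : t != 0.
Proof.
apply/eqP=> t0; have [|/eqP] := frame_unitP t a b gu 1 0 0.
  by rewrite t0 scaler0 !scale0r !addr0.
by rewrite oner_eq0.
Qed.

Lemma tangent_points (T : point L 3) : (T :=: t)%MS ->
  free2 (form phi a) (form phi b) ->
  points_on (conf (frame t a b)) l = [set T].
Proof.
move=> Tt fr; apply/setP=> P; rewrite in_set in_set1.
apply/andP/eqP=> [[/conf_pointP[x [y [z [xyz0 PE]]]]]|->].
  rewrite PE phiP formE => /eqP/fr[y0 z0]; subst y z.
  apply: flat_inj; apply/eqmxP; apply: (eqmx_trans PE).
  rewrite rmorph0 !scale0r !addr0; apply: eqmx_trans (eqmx_sym Tt).
  apply: eqmx_scale; rewrite fmorph_eq0.
  by move: xyz0; rewrite rv3_eq0 eqxx !andbT.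
split; last by rewrite Tt phiP phit.
apply/conf_pointP; exists 1, 0, 0; rewrite rv3_eq0 oner_eq0; split=> //.
by rewrite rmorph1 rmorph0 scale1r !scale0r !addr0.
Qed.

(** A nontrivial relation over [F] would put the subplane point [x a + y b] on [l]; it would have to
    coincide with [t], against the independence of the frame. *)
Lemma tangent_free : #|points_on (conf (frame t a b)) l| == 1 ->
  free2 (form phi a) (form phi b).
Proof.
case/cards1P=> P PE x y xy0.
have onP Q : Q \in (conf (frame t a b)).1 -> (Q <= l)%MS -> Q = P.
  by move=> Qc Ql; apply/set1P; rewrite -PE in_set Qc.
have [T Tt] := point_of t_neq0.
have TP : T = P.
  apply: onP; last by rewrite Tt phiP phit.
  apply/conf_pointP; exists 1, 0, 0; rewrite rv3_eq0 oner_eq0; split=> //.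
  by rewrite rmorph1 rmorph0 scale1r !scale0r !addr0.
suff /andP[/eqP-> /eqP->] : (x == 0) && (y == 0) by [].
rewrite -[_ && _]negbK; apply/negP=> xyn.
have abE : iota x *: a + iota y *: b = 0 *: t + iota x *: a + iota y *: b.
  by rewrite scale0r add0r.
have ab0 : iota x *: a + iota y *: b != 0.
  apply/eqP; rewrite abE => /(frame_unitP _ _ _ gu)[_ /eqP + /eqP].
  by rewrite !fmorph_eq0 => x0 y0; rewrite x0 y0 in xyn.
have [Q Qab] := point_of ab0.
have QT : Q = T.
  rewrite TP; apply: onP; last by rewrite Qab phiP abE formE xy0.
  apply/conf_pointP; exists 0, x, y; rewrite rmorph0 -abE rv3_eq0 eqxx.
  by split.
have : ((iota x *: a + iota y *: b)%R <= t)%MS by rewrite -Qab QT Tt.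
case/sub_rVP=> c; rewrite abE => ct.
have [|_ /eqP + /eqP] := @frame_inj _ t a b 0 (iota x) (iota y) c 0 0 gu.
  by rewrite ct !scale0r !addr0.
by rewrite !fmorph_eq0 => x0 y0; rewrite x0 y0 in xyn.
Qed.

(* In the coordinates of the frame, the line with normal n meets l in the cross
   product of n and (0, phi a, phi b); n = (0, _, _) gives t, and n = (1, y, - x)
   the other points. *)
Lemma mem_splash (P : point L 3) : free2 (form phi a) (form phi b) ->
  P \in splash (conf (frame t a b)) l <->
  (P :=: t)%MS \/ exists x y : F,
    (P :=: ((iota x * form phi a + iota y * form phi b) *: t
              + (form phi a *: b - form phi b *: a))%R)%MS.
Proof.
set al := form phi a; set be := form phi b => fr.
have al0 := free2_neq0 fr.
have swapE s : s *: t + (al *: b - be *: a) = s *: t + (- be) *: a + al *: b.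
  by rewrite scaleNr -addrA [- _ + _]addrC.
have tE : t = rv3 1 0 0 *m frame t a b.
  by rewrite mul_frame scale1r !scale0r !addr0.
rewrite in_set; split.
  case/andP=> Pl /existsP[c /andP[cg Pc]].
  have [n0 [n1 [n2 [n_neq0 cE]]]] := conf_line_normal gu cg.
  have [v v0 Pv] := point_rep P.
  have [x [y [z vE]]] := frame_span v gu.
  move: Pl Pc; rewrite !Pv vE phiP formE -mul_frame cE -/al -/be.
  (* The form vanishes at the point, so its last two coordinates are [mu] times [(- be, al)]. *)
  move=> /eqP yz /eqP; have [mu zE] : exists mu, z = mu * al.
    by exists (z / al); rewrite divfK.
  have yE : y = - mu * be.
    by apply: (mulIf al0); apply: subr0_eq; rewrite -yz zE; ring.
  rewrite {}yE {}zE {yz} in vE *; have [n00|n00] := eqVneq n0 0.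
    rewrite n00 rmorph0 mulr0 add0r => mun; left.
    (* A nonzero [mu] would give a relation over [F] between [al] and [be], hence a zero normal; so
       [mu = 0] and the point is [t]. *)
    have : mu * (iota n2 * al + iota (- n1) * be) == 0.
      by rewrite -mun rmorphN; apply/eqP; ring.
    rewrite mulf_eq0 => /orP[/eqP mu0|/eqP/fr[n20 /eqP]]; last first.
      by rewrite oppr_eq0 => n10; rewrite rv3_eq0 n00 n20 n10 !eqxx in n_neq0.
    rewrite vE mu0 !(oppr0, mul0r, scale0r, addr0) in v0 Pv.
    apply: (eqmx_trans Pv); apply: eqmx_scale.
    by apply: contraNneq v0 => ->; rewrite scale0r.
  move=> xE; right; exists (- n2 / n0), (n1 / n0).
  have {}xE : x = mu * (iota (- n2 / n0) * al + iota (n1 / n0) * be).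
    rewrite !fmorph_div rmorphN /=; have : iota n0 != 0 by rewrite fmorph_eq0.
    move=> in0; apply: (mulIf in0).
    apply: subr0_eq; rewrite -[RHS]xE; field; exact: in0.
  have vE' : v = mu *: ((iota (- n2 / n0) * al + iota (n1 / n0) * be) *: t
                          + (al *: b - be *: a)).
    by rewrite vE swapE xE !scalerDr !scalerA mulrN (mulNr mu).
  have mu0 : mu != 0 by apply: contraNneq v0 => mu0; rewrite vE' mu0 scale0r.
  by apply: (eqmx_trans Pv); rewrite vE'; apply: eqmx_scale.
case=> [Pt|[x [y Pxy]]].
  rewrite Pt phiP phit eqxx; apply/existsP.
  have [|c cg cP] := @conf_line_of _ 0 0 1 gu.
    by rewrite rv3_eq0 oner_eq0 !andbF.
  exists c; rewrite cg Pt tE cP //.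
  by rewrite rmorph0 !mulr0 !mul0r !addr0.
have [|c cg cP] := @conf_line_of _ 1 y (- x) gu.
  by rewrite rv3_eq0 oner_eq0.
rewrite Pxy swapE phiP formE; apply/andP; split.
  by rewrite -/al -/be; apply/eqP; ring.
apply/existsP; exists c; rewrite cg Pxy swapE -mul_frame cP //.
by rewrite rmorph1 rmorphN /=; ring.
Qed.

End WithFrame.
End Tangency.

(** * Counting *)

Section Pairs.

Variable K : fieldType.

Definition pair_mx n (x y : 'rV[K]_n) : 'M[K]_(2, n) := \matrix_i [:: x; y]`_i.

Lemma pair_mxE n (B : 'M[K]_(2, n)) : B = pair_mx (row 0 B) (row 1 B).
Proof.
apply/row_matrixP=> i; rewrite rowK.
by case: i => [[|[|]]] //= ?; congr (row _ B); apply: val_inj.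
Qed.

Lemma mul_pair_mx n (u : 'rV[K]_2) (x y : 'rV[K]_n) :
  u *m pair_mx x y = u 0 0 *: x + u 0 1 *: y.
Proof.
rewrite mulmx_sum_row !big_ord_recl big_ord0 addr0 !rowK.
by congr (_ + u 0 _ *: _); apply: val_inj.
Qed.

Lemma rv2_eq0 (u : 'rV[K]_2) : u 0 0 = 0 -> u 0 1 = 0 -> u = 0.
Proof.
move=> u0 u1; apply/rowP=> i; rewrite [RHS]mxE.
by case: i => [[|[|]]] //= ?; [rewrite -u0 | rewrite -u1]; congr (u 0 _);
  apply: val_inj.
Qed.

Lemma mul_frame_r (x y z : 'rV[K]_3) (g : 'M[K]_3) :
  frame x y z *m g = frame (x *m g) (y *m g) (z *m g).
Proof.
by apply/row_matrixP=> i; rewrite row_mul !rowK; case: i => [[|[|[|]]]].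
Qed.

Lemma frameZ c (x y z : 'rV[K]_3) :
  c *: frame x y z = frame (c *: x) (c *: y) (c *: z).
Proof.
by apply/row_matrixP=> i; rewrite linearZ /= !rowK; case: i => [[|[|[|]]]].
Qed.

End Pairs.

(** * Tangent subplanes through a fixed subline, in adapted coordinates *)

Section Count.

Variables (F L : finFieldType) (iota : {rmorphism F -> L}).
Local Notation "A ^f" := (map_mx iota A) : ring_scope.

Variables (l : line L 3) (phi : 'cV[L]_3).
Hypothesis phiP : forall x : 'rV_3, (x <= l)%MS = (form phi x == 0).

Variables (t p e : 'rV[L]_3).
Hypothesis G_unit : frame t p e \in unitmx.
Hypotheses (phit : form phi t = 0) (phip : form phi p = 1).
Hypothesis phie : form phi e = 0.

Variables alpha beta : L.
Hypothesis free_ab : free2 iota alpha beta.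

Definition comb (x y : F) : L := iota x * alpha + iota y * beta.

Lemma comb_inj x y x' y' : comb x y = comb x' y' -> x = x' /\ y = y'.
Proof.
rewrite /comb => exy.
have [|/subr0_eq-> /subr0_eq->] // := @free_ab (x - x') (y - y').
by rewrite !rmorphB !mulrBl addrACA -opprD exy subrr.
Qed.

(** The free overall scalar is spent on making the coefficient of [e] equal to 1, which leaves a
    common factor [v] on [t] and [p]. *)
Definition adapted (v u s : L) : 'M[L]_3 :=
  frame (v *: t) (v *: p) (s *: t + u *: p + e).

Lemma mul_adapted x y z v u s : rv3 x y z *m adapted v u s =
  (x * v + z * s) *: t + (y * v + z * u) *: p + z *: e.
Proof.
rewrite mul_frame !scalerDr !scalerDl !scalerA -!addrA; congr (_ + _).
by rewrite addrCA; congr (_ + _); rewrite addrCA.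
Qed.

Lemma adapted_unit v u s : v != 0 -> adapted v u s \in unitmx.
Proof.
move=> v0; apply/frame_unitP=> x y z xyz.
have [|xv yv z0] := frame_unitP _ _ _ G_unit (x * v + z * s) (y * v + z * u) z.
  by rewrite -mul_adapted mul_frame.
move: xv yv; rewrite z0 !mul0r !addr0 => /eqP + /eqP.
by rewrite !mulf_eq0 (negPf v0) !orbF => /eqP-> /eqP->.
Qed.

Lemma adapted_form v u s : [/\ form phi (v *: t) = 0, form phi (v *: p) = v
  & form phi (s *: t + u *: p + e) = u].
Proof. by rewrite !formD !formZ phit phip phie !mulr0 !mulr1 add0r addr0. Qed.

(** In the description by [mem_splash] the terms in [p] cancel and a factor [v] comes out, leaving
    [s t + e] shifted by the span of [v] and [u]. *)
Lemma adapted_splash v u s (P : point L 3) : free2 iota v u ->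
  P \in splash (conf iota (adapted v u s)) l <->
  (P :=: t)%MS \/
  exists x y : F, (P :=: ((iota x * v + iota y * u + s) *: t + e)%R)%MS.
Proof.
move=> fr; have v0 := free2_neq0 fr; have [f1 f2 f3] := adapted_form v u s.
have vt : (v *: t :=: t)%MS by apply: eqmx_scale.
have vxy x y : (((iota x * v + iota y * u) *: (v *: t)
      + (v *: (s *: t + u *: p + e) - u *: (v *: p)))%R
    :=: ((iota x * v + iota y * u + s) *: t + e)%R)%MS.
  apply: eqmx_trans (eqmx_scale _ v0); apply/eqmxP.
  suff -> : (iota x * v + iota y * u) *: (v *: t)
      + (v *: (s *: t + u *: p + e) - u *: (v *: p))
    = v *: ((iota x * v + iota y * u + s) *: t + e) by rewrite !submx_refl.
  rewrite !scalerDr !scalerA [u * v]mulrC addrAC addrK addrA -scalerDl.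
  by congr (_ *: _ + _); ring.
have := @mem_splash _ _ iota _ _ phiP _ _ _ (adapted_unit u s v0) f1 P.
rewrite f2 f3 => /(_ fr) ->; split=> [] [Pt|[x [y Pxy]]].
- by left; apply: eqmx_trans Pt vt.
- by right; exists x, y; apply: eqmx_trans Pxy (vxy x y).
- by left; apply: eqmx_trans Pt (eqmx_sym vt).
- by right; exists x, y; apply: eqmx_trans Pxy (eqmx_sym (vxy x y)).
Qed.

Let t_neq0 : t != 0.
Proof.
apply/eqP=> t0; have [|/eqP] := frame_unitP t p e G_unit 1 0 0.
  by rewrite t0 scaler0 !scale0r !addr0.
by rewrite oner_eq0.
Qed.

Lemma affine_point w : exists P : point L 3, (P :=: (w *: t + e)%R)%MS.
Proof.
apply: point_of; apply/eqP=> wte.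
have [|_ _ /eqP] := frame_unitP t p e G_unit w 0 1.
  by rewrite scale0r scale1r addr0.
by rewrite oner_eq0.
Qed.

Lemma affine_point_inj (P : point L 3) w w' :
  (P :=: (w *: t + e)%R)%MS -> (P :=: (w' *: t + e)%R)%MS -> w = w'.
Proof.
move=> Pw Pw'; have : ((w *: t + e)%R <= (w' *: t + e)%R)%MS.
  by rewrite -Pw Pw'.
case/sub_rVP=> c; rewrite scalerDr scalerA => wE.
have [|-> _ <-] := @frame_inj _ t p e w 0 1 (c * w') 0 c G_unit.
  by rewrite !scale0r scale1r !addr0.
by rewrite mul1r.
Qed.

Lemma affine_point_neq (P : point L 3) w :
  (P :=: (w *: t + e)%R)%MS -> (P :=: t)%MS -> False.
Proof.
move=> Pw Pt; have : ((w *: t + e)%R <= t)%MS by rewrite -Pw Pt.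
case/sub_rVP=> c wE.
have [|_ _ /eqP] := @frame_inj _ t p e w 0 1 c 0 0 G_unit.
  by rewrite !scale0r scale1r !addr0.
by rewrite oner_eq0.
Qed.

Variable S : {set point L 3}.
Hypothesis memS : forall P : point L 3, P \in S <->
  (P :=: t)%MS \/ exists x y, (P :=: (comb x y *: t + e)%R)%MS.

(** The map from [w] to the point [<w t + e>] is injective and misses [<t>], so comparing splashes
    amounts to comparing subsets of [L]. *)
Lemma adapted_splashE v u s : free2 iota v u ->
  splash (conf iota (adapted v u s)) l = S <->
  forall w, (exists x y : F, w = iota x * v + iota y * u + s) <->
            (exists x y, w = comb x y).
Proof.
move=> fr; split=> [splS w|same].
  have [P Pw] := affine_point w; split=> [] [x [y wE]].
    have : P \in S.
      rewrite -splS; apply/(adapted_splash _ _ fr); right; exists x, y.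
      by rewrite -wE.
    case/memS=> [/(affine_point_neq Pw) //|[x' [y' Pxy]]].
    by exists x', y'; apply: affine_point_inj Pw Pxy.
  have : P \in splash (conf iota (adapted v u s)) l.
    by rewrite splS; apply/memS; right; exists x, y; rewrite -wE.
  case/(adapted_splash _ _ fr)=> [/(affine_point_neq Pw) //|[x' [y' Pxy]]].
  by exists x', y'; apply: affine_point_inj Pw Pxy.
apply/setP=> P; apply/idP/idP.
  case/(adapted_splash _ _ fr)=> [Pt|[x [y Pxy]]]; apply/memS; first by left.
  have [|x' [y' E]] := (same (iota x * v + iota y * u + s)).1.
    by exists x, y.
  by right; exists x', y'; rewrite -E.
case/memS=> [Pt|[x [y Pxy]]]; apply/(adapted_splash _ _ fr); first by left.
have [|x' [y' E]] := (same (comb x y)).2; first by exists x, y.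
by right; exists x', y'; rewrite -E.
Qed.

(** * Subplanes with the given splash, parametrised by coordinates over [F] *)

Definition param (v0 v1 u0 u1 s0 s1 : F) : plane_config L :=
  conf iota (adapted (comb v0 v1) (comb u0 u1) (comb s0 s1)).

Lemma free2_comb v0 v1 u0 u1 : v0 * u1 - v1 * u0 != 0 ->
  free2 iota (comb v0 v1) (comb u0 u1).
Proof.
move=> d0 x y xy0.
have [|xv yv] := @free_ab (x * v0 + y * u0) (x * v1 + y * u1).
  by rewrite -xy0 /comb; ring.
have xd : x * (v0 * u1 - v1 * u0) = 0.
  transitivity (u1 * (x * v0 + y * u0) - u0 * (x * v1 + y * u1)); first ring.
  by rewrite xv yv !mulr0 subr0.
have yd : y * (v0 * u1 - v1 * u0) = 0.
  transitivity (v0 * (x * v1 + y * u1) - v1 * (x * v0 + y * u0)); first ring.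
  by rewrite xv yv !mulr0 subr0.
by split; apply: (mulIf d0); rewrite mul0r.
Qed.

Lemma param_splash v0 v1 u0 u1 s0 s1 : v0 * u1 - v1 * u0 != 0 ->
  splash (param v0 v1 u0 u1 s0 s1) l = S.
Proof.
move=> d0; apply/(adapted_splashE _ (free2_comb d0)) => w.
split=> [] [x [y ->]].
  by exists (x * v0 + y * u0 + s0), (x * v1 + y * u1 + s1); rewrite /comb; ring.
set d := v0 * u1 - v1 * u0 in d0.
(* Cramer's rule for [k1 v + k2 u = (x, y) - s] in coordinates. *)
pose k1 := ((x - s0) * u1 - (y - s1) * u0) / d.
pose k2 := (v0 * (y - s1) - v1 * (x - s0)) / d; exists k1, k2.
transitivity (comb (k1 * v0 + k2 * u0 + s0) (k1 * v1 + k2 * u1 + s1)).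
  by congr comb; rewrite /k1 /k2 /d; field.
by rewrite /comb; ring.
Qed.

(** The affine plane [s + <v, u>] equals the span of [alpha] and [beta], so [s], [v + s] and [u + s]
    lie in that span, and by differences [v] and [u] do too. *)
Lemma splash_param v u s : free2 iota v u ->
  splash (conf iota (adapted v u s)) l = S ->
  exists v0 v1 u0 u1 s0 s1, v0 * u1 - v1 * u0 != 0 /\
    conf iota (adapted v u s) = param v0 v1 u0 u1 s0 s1.
Proof.
move=> fr /(adapted_splashE _ fr) same.
have [|s0 [s1 sE]] := (same s).1.
  by exists 0, 0; rewrite rmorph0 !mul0r !add0r.
have [|v0 [v1 vE]] := (same (v + s)).1.
  by exists 1, 0; rewrite rmorph0 rmorph1 mul0r mul1r addr0.
have [|u0 [u1 uE]] := (same (u + s)).1.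
  by exists 0, 1; rewrite rmorph0 rmorph1 mul0r mul1r add0r.
have {}vE : v = comb (v0 - s0) (v1 - s1).
  by apply: (addIr s); rewrite vE sE /comb; ring.
have {}uE : u = comb (u0 - s0) (u1 - s1).
  by apply: (addIr s); rewrite uE sE /comb; ring.
exists (v0 - s0), (v1 - s1), (u0 - s0), (u1 - s1), s0, s1.
split; last by rewrite /param -vE -uE -sE.
set v0' := v0 - s0 in vE *; set v1' := v1 - s1 in vE *.
set u0' := u0 - s0 in uE *; set u1' := u1 - s1 in uE *.
(* With zero determinant, the rows of the adjugate give relations between [v] and [u], which force
   both coordinates of [v] to vanish. *)
apply/eqP=> d0; have := free2_neq0 fr.
have [u10 v10] : u1' = 0 /\ - v1' = 0.
  apply: fr; rewrite vE uE /comb.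
  transitivity (iota (v0' * u1' - v1' * u0') * alpha); first ring.
  by rewrite d0 rmorph0 mul0r.
have [u00 v00] : - u0' = 0 /\ v0' = 0.
  apply: fr; rewrite vE uE /comb.
  transitivity (iota (v0' * u1' - v1' * u0') * beta); first ring.
  by rewrite d0 rmorph0 mul0r.
rewrite vE v00 -[v1']opprK v10 /comb oppr0 rmorph0 !mul0r addr0 eqxx //.
Qed.

(** The frame changes by the matrix over [F] with rows [(k, 0, 0)], [(0, k, 0)], [(y, x, 1)], which
    is invertible. *)
Lemma param_move k x y v0 v1 u0 u1 s0 s1 : k != 0 ->
  param (k * v0) (k * v1) (u0 + x * v0) (u1 + x * v1)
        (s0 + y * v0) (s1 + y * v1)
  = param v0 v1 u0 u1 s0 s1.
Proof.
move=> k0; pose X := frame (rv3 k 0 0) (rv3 0 k 0) (rv3 y x 1).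
have Xu : X \in unitmx.
  apply/frame_unitP=> a b c abc.
  (* Here [i] is any natural number; beyond 2 the list entries are the default 0. *)
  have cE i :
      a * [:: k; 0; 0]`_i + b * [:: 0; k; 0]`_i + c * [:: y; x; 1]`_i = 0.
    case: (ltnP i 3) => [i3|i3]; last by rewrite !nth_default // !mulr0 !addr0.
    by have /rowP/(_ (Ordinal i3)) := abc; rewrite !mxE.
  have := (cE 0, cE 1, cE 2); rewrite /= !mulr0 !mulr1 !addr0 !add0r.
  case=> [[+ +] c0]; rewrite c0 !mul0r !addr0 => /eqP + /eqP.
  by rewrite !mulf_eq0 (negPf k0) !orbF => /eqP-> /eqP->.
rewrite /param -(confM iota (adapted (comb v0 v1) _ _) Xu).
congr (conf _ _); rewrite /adapted.
have -> : X^f = frame (rv3 k 0 0)^f (rv3 0 k 0)^f (rv3 y x 1)^f.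
  by apply/row_matrixP=> i; rewrite -map_row !rowK; case: i => [[|[|[|]]]].
rewrite mul_frame_r !map_rv3 !mul_frame !rmorph0 rmorph1 !scale0r !addr0 add0r.
rewrite scale1r !scalerA addrA; congr (frame (_ *: _) (_ *: _) _).
- by rewrite /comb; ring.
- by rewrite /comb; ring.
rewrite addrACA -!scalerDl; congr (_ *: _ + _ *: _ + _).
  by rewrite /comb; ring.
by rewrite /comb; ring.
Qed.

(** The frames of equal subplanes differ by a scalar [c] and a matrix [X] over [F]; comparing
    coefficients in the basis [t, p, e] on the first and last rows leaves only the changes made by
    [param_move]. *)
Lemma param_eq v0 v1 u0 u1 s0 s1 v0' v1' u0' u1' s0' s1' :
  v0 * u1 - v1 * u0 != 0 -> v0' * u1' - v1' * u0' != 0 ->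
  param v0' v1' u0' u1' s0' s1' = param v0 v1 u0 u1 s0 s1 ->
  exists k x y : F, [/\ v0' = k * v0 /\ v1' = k * v1,
    u0' = u0 + x * v0 /\ u1' = u1 + x * v1
    & s0' = s0 + y * v0 /\ s1' = s1 + y * v1].
Proof.
move=> /free2_comb/free2_neq0 v_neq0 /free2_comb/free2_neq0 v'_neq0 [eqP1 _].
have [||c [X XE]] := @sub_image_points _ _ iota _ _
  (adapted (comb v0' v1') (comb u0' u1') (comb s0' s1')) _
  _ (adapted_unit (comb u0 u1) (comb s0 s1) v_neq0).
- by rewrite row_free_unit adapted_unit.
- by rewrite eqP1.
have [x00 [x01 [x02 X0]]] := rv3E (row 0 X).
have [x20 [x21 [x22 X2]]] := rv3E (row (lift 0 1) X).
have := congr1 (row 0) XE; rewrite rowK linearZ /= row_mul -map_row X0.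
rewrite map_rv3 mul_adapted -[in LHS](addr0 (_ *: t)) -(scale0r p).
rewrite -[in LHS](addr0 (_ + _)) -(scale0r e) !scalerDr !scalerA.
case/(frame_inj G_unit)=> vE _ cx02.
have := congr1 (row (lift 0 1)) XE; rewrite rowK linearZ /= row_mul -map_row X2.
rewrite map_rv3 mul_adapted -[in LHS](scale1r e) !scalerDr !scalerA.
case/(frame_inj G_unit)=> sE uE cx22.
have x22_neq0 : iota x22 != 0.
  by apply: contra_eq_neq cx22 => ->; rewrite mulr0 oner_neq0.
(* The coefficient of [e] in the last row is 1, so [c] comes from [F]; in the first row it is 0,
   which kills [x02]. *)
have cE : c = iota x22^-1.
  by apply: (mulIf x22_neq0); rewrite fmorphV mulVf // -[LHS]cx22.
have x02_0 : iota x02 = 0.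
  apply: (mulfI (_ : c != 0)); last by rewrite mulr0.
  by rewrite cE fmorphV invr_eq0.
exists (x00 / x22), (x21 / x22), (x20 / x22); split; apply: comb_inj.
- by rewrite vE x02_0 cE /comb; ring.
- rewrite uE mulrDr !mulrA -cx22 mul1r cE /comb; ring.
- rewrite sE mulrDr !mulrA -cx22 mul1r cE /comb; ring.
Qed.

Lemma adapted_points v u s (T : point L 3) : (T :=: t)%MS -> free2 iota v u ->
  points_on (conf iota (adapted v u s)) l = [set T].
Proof.
move=> Tt fr; have v_neq0 := free2_neq0 fr.
have [f1 f2 f3] := adapted_form v u s.
apply: (tangent_points phiP f1); last by rewrite f2 f3.
by apply: eqmx_trans Tt (eqmx_sym (eqmx_scale _ v_neq0)).
Qed.

Lemma sub_adapted v u s : v != 0 ->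
  image_flats iota 1 (pair_mx t p) \subset (conf iota (adapted v u s)).1.
Proof.
move=> v_neq0; apply/subsetP=> P /image_pointsP[w w_neq0 Pw].
apply/conf_pointP; exists (w 0 0), (w 0 1), 0; split.
  apply: contraNneq w_neq0 => /eqP; rewrite rv3_eq0.
  case/and3P=> /eqP w0 /eqP w1 _.
  by apply/eqP/rv2_eq0.
rewrite rmorph0 scale0r addr0; apply: (eqmx_trans Pw).
rewrite mul_pair_mx !mxE; apply/eqmxP.
rewrite !scalerA !(mulrC _ v) -!scalerA -scalerDr.
by rewrite !eqmx_scale // submx_refl.
Qed.

(** By [sub_image_points], [t] and [p] are, up to one common scalar, combinations over [F] of the
    rows of [g]. Completing these to a basis and dividing by the coefficient of [e] in the third
    vector gives an adapted frame. *)
Lemma conf_adapted pi : subplane iota pi -> #|points_on pi l| == 1 ->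
  image_flats iota 1 (pair_mx t p) \subset pi.1 ->
  exists v u s, free2 iota v u /\ pi = conf iota (adapted v u s).
Proof.
case/subplaneP=> g gu -> card1 sub.
have rB : row_free (pair_mx t p).
  rewrite -kermx_eq0; apply/eqP/row_matrixP=> i; rewrite row0.
  set w := row i _; have : w *m pair_mx t p = 0.
    by apply/eqP; rewrite -sub_kermx row_sub.
  rewrite mul_pair_mx => wtp.
  have [|w0 w1 _] := frame_unitP t p e G_unit (w 0 0) (w 0 1) 0.
    by rewrite wtp scale0r addr0.
  exact: rv2_eq0.
have [c [X XE]] := sub_image_points rB gu sub.
have rX : row_free X.
  rewrite /row_free eqn_leq rank_leq_row -(mxrank_map iota X).
  apply: leq_trans (mxrankM_maxl _ (c *: g)).
  by rewrite -scalemxAr -XE (eqP rB).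
have c_neq0 : c != 0.
  apply: contraTneq rB => c0; rewrite XE c0 scale0r /row_free mxrank0.
  by [].
have [Y Yu YX] := @row_free_extend _ 2 1 X rX.
pose h := c *: (Y^f *m g).
have confh : conf iota h = conf iota g by rewrite confZ // confM.
have hu : h \in unitmx.
  by rewrite unitmxZ ?unitfE // unitmx_mul gu map_unitmx Yu.
have row_h i : row (lshift 1 i) h = row i (pair_mx t p).
  by rewrite XE -YX !linearZ /= !row_mul -!map_row row_usubmx.
have hE : h = frame t p (row (lift 0 1) h).
  rewrite {1}[h]frameE; congr frame.
    by have := row_h 0; rewrite rowK /= => <-; congr (row _ h); apply: val_inj.
  by have := row_h 1; rewrite rowK /= => <-; congr (row _ h); apply: val_inj.
have [b0 [b1 [b2 bE]]] := frame_span (row (lift 0 1) h) G_unit.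
have b2_neq0 : b2 != 0.
  apply/eqP=> b20; move: hu; rewrite hE bE b20 => hu.
  have [|_ _ /eqP] := frame_unitP _ _ _ hu b0 b1 (- 1).
    by rewrite scale0r addr0 scaleN1r subrr.
  by rewrite oppr_eq0 oner_eq0.
have E : conf iota g = conf iota (adapted b2^-1 (b1 / b2) (b0 / b2)).
  rewrite -confh -(confZ iota h (_ : b2^-1 != 0)) ?invr_eq0 //.
  congr conf; rewrite hE bE frameZ /adapted !scalerDr !scalerA mulVf // scale1r.
  by rewrite ![_ / b2]mulrC.
exists b2^-1, (b1 / b2), (b0 / b2); split => //.
have b2V : b2^-1 != 0 by rewrite invr_eq0.
have [f1 f2 f3] := adapted_form b2^-1 (b1 / b2) (b0 / b2).
rewrite -[X in free2 _ X]f2 -[X in free2 _ _ X]f3.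
by apply: (tangent_free phiP (adapted_unit _ _ b2V) f1); rewrite -E.
Qed.

(* Some k and None index the lines of the F-plane spanned by alpha and beta. *)
Definition normal_param (ocd : option F * F * F) : plane_config L :=
  let: (o, c, d) := ocd in
  if o is Some k then param 1 k 0 c 0 d else param 0 1 c 0 d 0.

(** The directions [(1, k)] and [(0, 1)] are pairwise non-proportional, and [u] and [s] are zero
    where [v] has its leading 1; hence no change allowed by [param_eq] relates two normal forms. *)
Lemma normal_param_inj :
  {in setX (setX [set: option F] [set~ 0]) [set: F] &, injective normal_param}.
Proof.
move=> [[o c] d] [[o' c'] d']; rewrite !inE !andbT => /= c0 c'0.
case: o o' => [k|] [k'|] /esym/param_eq.
- rewrite !mul1r !mulr0 !subr0 => /(_ c0 c'0)[z [x [y]]].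
  rewrite !mulr1 !add0r => -[[<- ->] [<- ->] [<- ->]].
  by rewrite mul1r !mul0r !addr0.
- rewrite !mul1r !mul0r !mulr0 !subr0 sub0r oppr_eq0 => /(_ c0 c'0)[z [x [y]]].
  rewrite !mulr1 => -[[<- /eqP]].
  by rewrite mul0r oner_eq0.
- rewrite !mul1r !mul0r !mulr0 !subr0 sub0r oppr_eq0 => /(_ c0 c'0)[z [x [y]]].
  by rewrite mulr0 => -[[/eqP]]; rewrite oner_eq0.
rewrite !mul1r !mul0r !sub0r !oppr_eq0 => /(_ c0 c'0)[z [x [y]]].
by rewrite !mulr0 !addr0 => -[_ [-> _] [-> _]].
Qed.

(** Row reduction by [param_move]: the first nonzero coordinate of [v] is scaled to 1 and that
    coordinate is cleared in [u] and [s]. *)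
Lemma param_normal v0 v1 u0 u1 s0 s1 : v0 * u1 - v1 * u0 != 0 ->
  exists2 ocd, ocd \in setX (setX [set: option F] [set~ 0]) [set: F] &
    param v0 v1 u0 u1 s0 s1 = normal_param ocd.
Proof.
move=> d0; have [v00|v00] := eqVneq v0 0.
  move: d0; rewrite v00 mul0r sub0r oppr_eq0 mulf_eq0 negb_or => /andP[v10 u00].
  exists (None, u0, s0); first by rewrite !inE u00.
  have v1V : v1^-1 != 0 by rewrite invr_eq0.
  rewrite -(param_move (- u1 / v1) (- s1 / v1) _ _ _ _ _ _ v1V) /=.
  by rewrite !mulr0 !addr0 mulVf // !divfK // !subrr.
exists (Some (v1 / v0), u1 - u0 / v0 * v1, s1 - s0 / v0 * v1).
  rewrite !inE andbT /=; apply: contraNneq d0 => E.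
  have -> : v0 * u1 - v1 * u0 = v0 * (u1 - u0 / v0 * v1) by field.
  by rewrite E mulr0.
have v0V : v0^-1 != 0 by rewrite invr_eq0.
rewrite -(param_move (- u0 / v0) (- s0 / v0) _ _ _ _ _ _ v0V) /=.
by rewrite mulVf // !mulNr !divfK // !subrr [v0^-1 * _]mulrC.
Qed.

Lemma card_tangent_subplanes :
  #|[set pi : plane_config L |
      [&& subplane iota pi, #|points_on pi l| == 1,
          image_flats iota 1 (pair_mx t p) \subset pi.1
        & splash pi l == S]]| = (#|F|.+1 * #|F|.-1 * #|F|)%N.
Proof.
have [T Tt] := point_of t_neq0.
have -> : #|F|.+1 = #|[set: option F]| by rewrite cardsT card_option.
have -> : #|F|.-1 = #|[set~ (0 : F)]| by rewrite cardsC1.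
rewrite -[X in (_ * X)%N]cardsT.
rewrite -!cardsX -(card_in_imset normal_param_inj); congr #|pred_of_set _|.
apply/setP=> pi; rewrite in_set; apply/and4P/imsetP.
  case=> pi_sub card1 m_sub /eqP spl.
  have [v [u [s [fr piE]]]] := conf_adapted pi_sub card1 m_sub.
  rewrite piE in spl.
  have [v0 [v1 [u0 [u1 [s0 [s1 [d0 E]]]]]]] := splash_param fr spl.
  have [ocd Docd ocdE] := param_normal s0 s1 d0.
  by exists ocd; rewrite // piE E.
case=> ocd Docd ->.
have [v0 [v1 [u0 [u1 [s0 [s1 [d0 ->]]]]]]] : exists v0 v1 u0 u1 s0 s1,
    v0 * u1 - v1 * u0 != 0 /\ normal_param ocd = param v0 v1 u0 u1 s0 s1.
  case: ocd Docd => [[[k|] c] d]; rewrite !inE andbT /= => c0.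
    by exists 1, k, 0, c, 0, d; rewrite mul1r mulr0 subr0.
  by exists 0, 1, c, 0, d, 0; rewrite mul1r mulr0 sub0r oppr_eq0.
have fr := free2_comb d0; have v_neq0 := free2_neq0 fr.
split; last by rewrite param_splash.
- by apply/subplaneP; eexists; last reflexivity; apply: adapted_unit.
- by rewrite (adapted_points _ Tt fr) cards1.
- exact: sub_adapted.
Qed.

End Count.

(** * Choice of coordinates for a given splash and subline *)

Lemma card_subplanes_with_splash (F L : finFieldType) (iota : {rmorphism F -> L})
    (linf : line L 3) (T : point L 3) (S : {set point L 3})
    (l : line L 3) (m : {set point L 3}) :
  tangent_splash iota linf T S -> l <> linf -> subline iota l m -> T \in m ->
  #|[set pi : plane_config L |
      [&& subplane iota pi, #|points_on pi linf| == 1,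
          m \subset pi.1 & splash pi linf == S]]|
  = (#|F|.+1 * #|F|.-1 * #|F|)%N.
Proof.
move=> splashS l_neq sublm Tm.
have [psi _ psiP] := form_of_corank1 (mxrank_flat linf).
have [_ /and3P[/subplaneP[g gu ->] /eqP onT /eqP splS]] := existsP splashS.
have : T \in points_on (conf iota g) linf by rewrite onT set11.
rewrite in_set => /andP[/image_pointsP[w w_neq0 Tw] Tlinf].
(* A change of basis over [F] makes the first vector of the given subplane represent [T]. *)
have [|Y Yu Yw] := @row_free_extend F 1 2 w.
  by rewrite /row_free rank_rV w_neq0.
pose h := map_mx iota Y *m g.
have hu : h \in unitmx by rewrite unitmx_mul gu map_unitmx Yu.
have confh : conf iota h = conf iota g by apply: confM.
have Tt : (T :=: row 0 h)%MS.
  apply: (eqmx_trans Tw); apply/eqmxP.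
  suff -> : row 0 h = map_mx iota w *m g by rewrite submx_refl.
  rewrite row_mul -map_row -Yw; congr (map_mx _ _ *m _).
  by apply/rowP=> j; rewrite !mxE; congr (Y _ j); apply: val_inj.
rewrite [h]frameE in hu confh.
move: (row 0 h) (row 1 h) (row (lift 0 1) h) hu confh Tt.
move=> {h Y Yu Yw w w_neq0 Tw} t a b hu confh Tt.
have [B /andP[/eqmxP Bl /eqP mB]] := existsP sublm.
move: Tm; rewrite mB => /image_pointsP[w w_neq0 Tw].
have [|Y Yu Yw] := @row_free_extend F 1 1 w.
  by rewrite /row_free rank_rV w_neq0.
(* The basis of the subline is rescaled so that its vector over [T] is [t] itself. *)
have [k k_neq0 tw] : exists2 k, k != 0 & t = k *: (map_mx iota w *m B).
  by apply/eq_rowP; rewrite -!Tt !Tw submx_refl.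
pose p0 := k *: row 1 (map_mx iota Y *m B).
have mp0 : k *: (map_mx iota Y *m B) = pair_mx t p0.
  rewrite [LHS]pair_mxE; congr pair_mx; last by rewrite linearZ.
  rewrite linearZ /= tw row_mul -map_row; congr (_ *: (map_mx _ _ *m _)).
  by rewrite -Yw; apply/rowP=> j; rewrite !mxE; congr (Y _ j); apply: val_inj.
clearbody p0.
have mE : image_flats iota 1 B = image_flats iota 1 (pair_mx t p0).
  by rewrite -mp0 image_flatsZ // image_flatsM.
have psit : form psi t = 0.
  by apply/eqP; rewrite -sub_ker_form -psiP -Tt.
(* Otherwise [t] and [p0], which span [l], would both lie on [linf]. *)
have psip_neq0 : form psi p0 != 0.
  apply/eqP=> psip; apply: l_neq; apply: flat_inj.
  rewrite -(geq_leqif (mxrank_leqif_eq _)) ?mxrank_flat // psiP -Bl.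
  have -> : B = invmx (map_mx iota Y) *m (k^-1 *: pair_mx t p0).
    by rewrite -mp0 scalerA mulVf // scale1r mulKmx // map_unitmx.
  apply: submx_trans (submxMl _ _) _.
  apply: submx_trans (scalemx_sub _ (submx_refl _)) _.
  apply/row_subP=> i; rewrite rowK sub_ker_form.
  by case: i => [[|[|]]] //= _; rewrite ?psit ?psip.
pose phi := (form psi p0)^-1 *: psi.
have phiE x : form phi x = (form psi p0)^-1 * form psi x.
  by rewrite /form /phi -scalemxAr mxE.
clearbody phi.
have phiP (x : 'rV_3) : (x <= linf)%MS = (form phi x == 0).
  by rewrite phiE mulf_eq0 invr_eq0 (negPf psip_neq0) psiP sub_ker_form.
have phit : form phi t = 0 by rewrite phiE psit mulr0.
have phip : form phi p0 = 1 by rewrite phiE mulVf.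
have fr : free2 iota (form phi a) (form phi b).
  by apply: (tangent_free phiP hu phit); rewrite confh onT cards1.
(* This is the vector that [mem_splash] attaches to the given subplane. *)
have [e eE] : exists e, e = form phi a *: b - form phi b *: a by eexists.
have phie : form phi e = 0.
  by rewrite eE -scaleNr formD !formZ mulNr mulrC subrr.
have Gu : frame t p0 e \in unitmx.
  (* Applying [phi] to a relation gives [y = 0]; the rest is a relation in the frame [t, a, b],
     where [form phi a] is nonzero. *)
  apply/frame_unitP=> x y z xyz.
  have y0 : y = 0.
    have := congr1 (form phi) xyz; rewrite !formD !formZ phit phip phie.
    rewrite !mulr0 mulr1 add0r addr0 => ->.
    by rewrite -(scale0r t) formZ mul0r.
  have [|-> _ /eqP] := frame_unitP _ _ _ hu
                         x (- (z * form phi b)) (z * form phi a).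
    rewrite -[RHS]xyz y0 scale0r addr0 eE scalerBr !scalerA scaleNr -addrA.
    by rewrite [- _ + _]addrC.
  by rewrite mulf_eq0 (negPf (free2_neq0 fr)) orbF => /eqP->.
have memS (P : point L 3) : P \in S <-> (P :=: t)%MS \/
    exists x y, (P :=: (comb iota (form phi a) (form phi b) x y *: t + e)%R)%MS.
  rewrite -splS -confh eE; exact: (mem_splash phiP hu phit P fr).
by rewrite mE (card_tangent_subplanes phiP Gu phit phip phie fr memS).
Qed.

Local Close Scope ring_scope.

Theorem theorem5p3 (q : nat) (F L : finFieldType) (iota : {rmorphism F -> L})
    (cardF : #|F| = q) (cardL : #|L| = q ^ 3)
    (linf : line L 3) (T : point L 3) (S : {set point L 3})
    (splashS : tangent_splash iota linf T S)
    (l : line L 3) (l_neq : l <> linf)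
    (m : {set point L 3}) (sublm : subline iota l m) (Tm : T \in m) :
  #|[set pi : plane_config L |
      [&& subplane iota pi,
          #|points_on pi linf| == 1,
          m \subset pi.1
        & splash pi linf == S]]| = q * (q ^ 2 - 1).
Proof.
rewrite (card_subplanes_with_splash splashS l_neq sublm Tm) cardF.
(* Difference of squares: [q ^ 2 - 1 ^ 2] is [(q - 1) * (q + 1)], also for truncated subtraction. *)
by rewrite -[1]/(1 ^ 2) subn_sqr addn1 subn1 mulnC [_.+1 * _]mulnC.
Qed.
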